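(* Consider an open multi-agent system with potential agents $\mathcal{V}=\{v_1,\dots,v_n\}$, active sets $\mathcal{V}(k)\subseteq\mathcal{V}$, and digraphs $\mathcal{G}(k)=(\mathcal{V}(k),\mathcal{E}(k))$, $k\ge 0$, and let $x_j(k),y_j(k),z_j(k)$ be generated by the OpenRC iteration with joining masses $\widehat{x}_j(k)$ and $\widehat{y}_j(k)$ (all as defined in the context). Suppose that $\mathcal{G}(k)$ is strongly connected for every $k\ge 0$, and that for every $k$ and every edge $\varepsilon_{ji}\in\mathcal{E}(k)$ agent $v_j$ is able to transmit a one-bit acknowledgement message to $v_i$. Suppose there exists a time $k'$ at which the network stabilizes, i.e. no further departures or arrivals occur, so that $\mathcal{V}(k)=\mathcal{V}(k')$ for all $k\ge k'$. Then the following holds for all $v_j\in\mathcal{V}(k')$ and all $k\ge k'$: $$\lim_{k\to\infty}z_j(k)=\lim_{k\to\infty}\frac{x_j(k)}{y_j(k)}=\frac{1}{|\mathcal{V}(k')|}\sum_{v_l\in\mathcal{V}(k')}\widehat{x}_l(k').$$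
   Context: **Open network.** $\mathcal{V}=\{v_1,\dots,v_n\}$ is a finite set of potential agents. At each time $k=0,1,2,\dots$ a subset $\mathcal{V}(k)\subseteq\mathcal{V}$ is active; $\alpha_j(k)=1$ if $v_j\in\mathcal{V}(k)$ and $\alpha_j(k)=0$ otherwise. The active agents communicate over a time-varying digraph $\mathcal{G}(k)=(\mathcal{V}(k),\mathcal{E}(k))$ with $\mathcal{E}(k)\subseteq\mathcal{V}(k)\times\mathcal{V}(k)$. The edge $\varepsilon_{ji}\in\mathcal{E}(k)$ means that $v_j$ receives information from $v_i$ at time $k$. There are no self-edges (each agent has access to its own state anyway). Put $\mathcal{N}_j^{\mathrm{in}}(k)=\{v_i\in\mathcal{V}(k):\varepsilon_{ji}\in\mathcal{E}(k)\}$ and $\mathcal{N}_j^{\mathrm{out}}(k)=\{v_l\in\mathcal{V}(k):\varepsilon_{lj}\in\mathcal{E}(k)\}$. A digraph is strongly connected if there is a directed path between every pair of nodes. Remaining, arriving and departing agents: $\mathcal{R}(k)=\mathcal{V}(k)\cap\mathcal{V}(k+1)$, $\mathcal{J}(k)=\mathcal{V}(k+1)\setminus\mathcal{V}(k)$, $\mathcal{D}(k)=\mathcal{V}(k)\setminus\mathcal{V}(k+1)$. **Joining masses.** Let $\mathcal{K}_j$ be the set of times $r$ at which $v_j$ (re-)joins the network, i.e. $\alpha_j(r)=1$ and $\alpha_j(r-1)=0$, with the convention $\alpha_j(-1)=0$ (so $0\in\mathcal{K}_j$ if $v_j\in\mathcal{V}(0)$). For each $r\in\mathcal{K}_j$ a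 real number $m_j(r)$ (the joining mass) is given. Define $\widehat{x}_j(k)=m_j(\max\{r\in\mathcal{K}_j: r\le k\})$ if $\alpha_j(k)=1$ and $\widehat{x}_j(k)=0$ otherwise. Define $\widehat{y}_j(k)=1$ if $\alpha_j(k)=1$ and $\widehat{y}_j(k)=0$ otherwise. **Weights.** At each time $k$ every out-neighbor $v_l$ of $v_j$ acknowledges with the bit $1$ if $v_l\in\mathcal{R}(k)$ and $0$ if $v_l\in\mathcal{D}(k)$; from these bits $v_j$ computes $|\mathcal{N}_j^{\mathrm{out}}(k)\cap\mathcal{R}(k)|$ and the following weights. If $v_j\in\mathcal{R}(k)$: $c_{lj}(k)=\dfrac{1}{1+|\mathcal{N}_j^{\mathrm{out}}(k)\cap\mathcal{R}(k)|}$ for $v_l\in(\mathcal{N}_j^{\mathrm{out}}(k)\cap\mathcal{R}(k))\cup\{v_j\}$, and $c_{lj}(k)=0$ otherwise. If $v_j\notin\mathcal{R}(k)$, then $c_{lj}(k)=0$ for all $l$. If $v_j\in\mathcal{D}(k)$: $\widetilde{c}_{lj}(k)=\dfrac{1}{|\mathcal{N}_j^{\mathrm{out}}(k)\cap\mathcal{R}(k)|}$ for $v_l\in\mathcal{N}_j^{\mathrm{out}}(k)\setminus\mathcal{D}(k)$, and $\widetilde{c}_{lj}(k)=0$ otherwise. If $v_j\notin\mathcal{D}(k)$, then $\widetilde{c}_{lj}(k)=0$ for all $l$. **OpenRC iteration.** Initially $x_j(0)=\widehat{x}_j(0)$ and $y_j(0)=\widehat{y}_j(0)$ for all $j$. For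 $k\ge 0$: - if $v_j\in\mathcal{J}(k)$: $x_j(k+1)=\widehat{x}_j(k+1)$, $y_j(k+1)=\widehat{y}_j(k+1)$, $z_j(k+1)=x_j(k+1)/y_j(k+1)$; - if $v_j\in\mathcal{R}(k)$: $$x_j(k+1)=\sum_{v_i\in(\mathcal{N}_j^{\mathrm{in}}(k)\cap\mathcal{R}(k))\cup\{v_j\}}c_{ji}(k)x_i(k)+\sum_{v_i\in\mathcal{N}_j^{\mathrm{in}}(k)\cap\mathcal{D}(k)}\widetilde{c}_{ji}(k)\big(x_i(k)-\widehat{x}_i(k)\big),$$ $y_j(k+1)$ is given by the same formula with $x,\widehat{x}$ replaced by $y,\widehat{y}$, and $z_j(k+1)=x_j(k+1)/y_j(k+1)$; - if $v_j\notin\mathcal{V}(k+1)$ (departing or inactive): $x_j(k+1)=y_j(k+1)=z_j(k+1)=0$.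
   Formalization: The formal theorem adds the assumption that at every time when some agent remains, each departing agent has at least one remaining out-neighbor (so its weight has a nonzero denominator); without this, surplus mass can be lost and the stated limit can fail. *)

(* Defs.v *)
From HB Require Import structures.
From mathcomp Require Import all_boot all_order all_algebra.
From mathcomp Require Import reals.

Set Implicit Arguments.
Unset Strict Implicit.
Unset Printing Implicit Defensive.

Import Order.TTheory GRing.Theory Num.Theory.

Local Open Scope ring_scope.

(** The pair [(j, i)] in [edges k] is the edge along which [j] receives
    information from [i] at time [k]. *)
Record open_network (n : nat) := OpenNetwork {
  active : nat -> {set 'I_n};
  edges : nat -> {set 'I_n * 'I_n};
  edges_active : forall k, edges k \subset setX (active k) (active k);
  edges_irrefl : forall k j, (j, j) \notin edges k
}.

Section Network.
Variables (n : nat) (N : open_network n).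
Implicit Types (k r : nat) (i j l : 'I_n).

Definition in_nbrs k j : {set 'I_n} :=
  [set i in active N k | (j, i) \in edges N k].
Definition out_nbrs k j : {set 'I_n} :=
  [set l in active N k | (l, j) \in edges N k].

Definition remaining k : {set 'I_n} := active N k :&: active N k.+1.
Definition arriving k : {set 'I_n} := active N k.+1 :\: active N k.
Definition departing k : {set 'I_n} := active N k :\: active N k.+1.

(** Paths cannot leave [active N k], by [edges_active]. *)
Definition strongly_connected k : Prop :=
  forall i j, i \in active N k -> j \in active N k ->
    connect [rel u v | (v, u) \in edges N k] i j.

Definition joins j r : bool :=
  (j \in active N r) && ((r == 0%N) || (j \notin active N r.-1)).

(** The maximum is over a nonempty set whenever [j] is active at time [k]. *)
Definition last_join j k : nat := \max_(r < k.+1 | joins j r) r.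

(** [(l, j)] in [link k] means that [l] is able to send a one-bit message to [j]
    at time [k]; [None] stands for a message that cannot be delivered. *)
Variable link : nat -> {set 'I_n * 'I_n}.

Definition ack k l j : option bool :=
  if (l, j) \in link k then Some (l \in remaining k) else None.

Definition ack_count k j : nat :=
  #|[set l in out_nbrs k j | ack k l j == Some true]|.

(** If the acknowledgement link exists for every edge, the weights below have the
    denominators [1 + #|out_nbrs k j :&: remaining k|] and
    [#|out_nbrs k j :&: remaining k|]. *)
Lemma ack_countE k j :
  (forall l, (l, j) \in edges N k -> (l, j) \in link k) ->
  ack_count k j = #|out_nbrs k j :&: remaining k|.
Proof.
move=> linkP; apply: eq_card => l; rewrite !inE /ack.
case: (boolP ((l, j) \in edges N k)) => [/linkP ->|_]; last by rewrite !andbF.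
by rewrite !inE; case: (_ \in _); case: (_ \in _).
Qed.

Variable R : realType.

Definition weight k l j : R :=
  if (j \in remaining k) && (l \in (out_nbrs k j :&: remaining k) :|: [set j])
  then 1 / (1 + (ack_count k j)%:R) else 0.

Definition dep_weight k l j : R :=
  if (j \in departing k) && (l \in out_nbrs k j :\: departing k)
  then 1 / (ack_count k j)%:R else 0.

(** [m j r] is only used at times [r] at which [j] joins. *)
Definition xhat (m : 'I_n -> nat -> R) k j : R :=
  if j \in active N k then m j (last_join j k) else 0.

Definition yhat k j : R := if j \in active N k then 1 else 0.

(** The recursion shared by the two coordinates of the iteration; [h] is the
    family of joining masses. *)
Fixpoint mass (h : nat -> 'I_n -> R) (k : nat) (j : 'I_n) : R :=
  if k is t.+1 then
    if j \in arriving t then h t.+1 j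
    else if j \in remaining t then
      \sum_(i in (in_nbrs t j :&: remaining t) :|: [set j])
         weight t j i * mass h t i
      + \sum_(i in in_nbrs t j :&: departing t)
         dep_weight t j i * (mass h t i - h t i)
    else 0
  else h 0%N j.

Definition openrc_x (m : 'I_n -> nat -> R) k j : R := mass (xhat m) k j.
Definition openrc_y k j : R := mass yhat k j.
Definition openrc_z (m : 'I_n -> nat -> R) k j : R :=
  if j \in active N k then openrc_x m k j / openrc_y k j else 0.

End Network.

(* Main.v *)
(** Once the network is stable, the iteration multiplies both coordinates by
    column-stochastic matrices with entries at least [1 / n.+1] on the diagonal and
    along edges. Over [#|A|] consecutive steps strong connectivity spreads a fixed
    fraction of every initial mass to every agent, so vectors of zero sum contract
    in the l1 norm. Applied to [x - r y], where [r] is the ratio of the total masses,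
    this gives [x / y --> r], provided that [y] stays away from [0]; this holds
    eventually because [y] differs by a zero-sum vector from a positive constant
    one. Finally the total masses at time [k'] are the sums of the joining masses:
    a departing agent hands over exactly what it holds in excess of its own. *)
Require Import Defs.
From mathcomp Require Import all_boot all_order all_algebra.
From mathcomp Require Import all_classical all_reals all_analysis.
From mathcomp Require Import fintype finset ring lra.
Import Order.TTheory GRing.Theory Num.Theory.
Import numFieldNormedType.Exports.
Local Open Scope classical_set_scope.
Local Open Scope ring_scope.

Set Implicit Arguments.
Unset Strict Implicit.
Unset Printing Implicit Defensive.

(** * Products of column-stochastic matrices on a fixed finite set: finite-time estimates *)

Fixpoint flow {R : realType} {T : finType} (A : {set T}) (W : nat -> T -> T -> R)
    (v : T -> R) (t : nat) (j : T) : R :=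
  if t is s.+1 then \sum_(i in A) W s j i * flow A W v s i else v j.

(** The last clause says that no proper subset of [A] retains all its mass; it is
    strong connectivity in the form of cuts. *)
Record mixing {R : realType} {T : finType} (A : {set T}) (beta : R)
    (W : nat -> T -> T -> R) : Prop := Mixing {
  mixing_gt0 : 0 < beta;
  mixing_ge0 : forall t i j, 0 <= W t j i;
  mixing_sum1 : forall t i, i \in A -> \sum_(j in A) W t j i = 1;
  mixing_diag : forall t i, i \in A -> beta <= W t i i;
  mixing_cut : forall t (S : {set T}), S \proper A -> S != set0 ->
    exists i j, [/\ i \in S, j \in A :\: S & beta <= W t j i] }.

Section Flow.
Context {R : realType} {T : finType} (A : {set T}).
Implicit Types (W : nat -> T -> T -> R) (u v w : T -> R) (beta : R).

Lemma mixing_shift beta W s :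
  mixing A beta W -> mixing A beta (fun t => W (t + s)%N).
Proof. by case=> b0 W0 W1 Wd Wc; split => // t; auto. Qed.

Lemma flow_shift W v s t j :
  flow A W v (t + s) j = flow A (fun r => W (r + s)%N) (flow A W v s) t j.
Proof. by elim: t j => //= t IH j; apply: eq_bigr => i _; rewrite IH. Qed.

Lemma eq_flow W u v t : {in A, u =1 v} -> {in A, flow A W u t =1 flow A W v t}.
Proof.
by move=> uv; elim: t => //= t IH j jA; apply: eq_bigr => i iA; rewrite IH.
Qed.

Lemma flowBZ W u w c t j :
  flow A W (fun i => u i - c * w i) t j = flow A W u t j - c * flow A W w t j.
Proof.
elim: t j => //= t IH j; rewrite mulr_sumr -sumrB; apply: eq_bigr => i _.
by rewrite IH; ring.
Qed.

Variables (beta : R) (W : nat -> T -> T -> R).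
Hypothesis mixW : mixing A beta W.

Lemma flow_sum v t : \sum_(j in A) flow A W v t j = \sum_(j in A) v j.
Proof.
elim: t => //= t <-; rewrite exchange_big /=; apply: eq_bigr => i iA.
by rewrite -mulr_suml (mixing_sum1 mixW) // mul1r.
Qed.

Lemma flow_ge0 v t j : {in A, forall i, 0 <= v i} -> j \in A ->
  0 <= flow A W v t j.
Proof.
move=> v0; elim: t j => [|t IH] j jA /=; first exact: v0.
by apply: sumr_ge0 => i iA; rewrite mulr_ge0 ?(mixing_ge0 mixW) ?IH.
Qed.

Lemma flow_le_step v t i j : {in A, forall i, 0 <= v i} -> i \in A -> j \in A ->
  W t j i * flow A W v t i <= flow A W v t.+1 j.
Proof.
move=> v0 iA jA /=; rewrite (bigD1 i) //= lerDl sumr_ge0 // => l /andP[lA _].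
by rewrite mulr_ge0 ?(mixing_ge0 mixW) ?flow_ge0.
Qed.

(** The agents holding at least [beta ^+ t * v i] gain a member at each step until they fill [A]:
    the diagonal bound keeps the old members, and [mixing_cut] supplies an edge to a new one. *)
Lemma flow_growth v t i : {in A, forall i, 0 <= v i} -> i \in A ->
  exists S : {set T}, [/\ S \subset A, i \in S, (minn t.+1 #|A| <= #|S|)%N
    & {in S, forall j, beta ^+ t * v i <= flow A W v t j}].
Proof.
move=> v0 iA; have b0 := mixing_gt0 mixW.
elim: t => [|t [S [SA iS cS Sv]]].
  exists [set i]%SET; split; rewrite ?sub1set ?inE ?cards1 ?geq_minl //.
  by move=> j; rewrite inE => /eqP -> /=; rewrite mul1r.
have step l j : l \in S -> j \in A -> beta <= W t j l ->
    beta ^+ t.+1 * v i <= flow A W v t.+1 j.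
  move=> lS jA Wb; apply: le_trans (flow_le_step t v0 (subsetP SA l lS) jA).
  rewrite exprS -mulrA ler_pM ?Sv ?(ltW b0) // mulr_ge0 ?v0 //.
  by rewrite exprn_ge0 ?(ltW b0).
have diag l : l \in S -> beta ^+ t.+1 * v i <= flow A W v t.+1 l.
  move=> lS; have lA := subsetP SA l lS.
  by apply: (step l) => //; exact: (mixing_diag mixW t lA).
have [AS|nAS] := boolP (A \subset S).
  have E : S = A by apply/eqP; rewrite eqEsubset SA.
  by exists S; split; rewrite // E geq_minr.
have [||l [j [lS]]] := mixing_cut mixW t (S := S).
- by rewrite properE SA.
- by apply/set0Pn; exists i.
rewrite inE => /andP[jS jA] Wb; exists (j |: S)%SET; split.
- by rewrite subUset sub1set jA.
- by rewrite in_setU1 iS orbT.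
- rewrite cardsU1 jS add1n.
  apply: leq_trans (_ : (minn t.+1 #|A|).+1 <= _)%N; last by rewrite ltnS.
  by rewrite -minnSS leq_min geq_minl (leq_trans (geq_minr _ _)).
- move=> r; rewrite in_setU1 => /orP[/eqP ->|]; last exact: diag.
  exact: step lS jA Wb.
Qed.

(** After [#|A|] steps the set from [flow_growth] is all of [A], whatever the starting agent. The
    resulting [#|A|] bounds, one for each start, are averaged rather than added, hence the division
    by [#|A|]. *)
Lemma flow_spread v j : {in A, forall i, 0 <= v i} -> j \in A ->
  beta ^+ #|A| / #|A|%:R * \sum_(i in A) v i <= flow A W v #|A| j.
Proof.
move=> v0 jA; have b0 := mixing_gt0 mixW.
have A0 : (0 < #|A|)%N by apply/card_gt0P; exists j.
have A0R : 0 < #|A|%:R :> R by rewrite ltr0n.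
rewrite mulrAC ler_pdivrMr // mulrC mulr_suml.
rewrite mulr_natr -sumr_const; apply: ler_sum => i iA.
have [S [SA _ cS Sv]] := flow_growth #|A| v0 iA.
rewrite mulrC Sv //; suff -> : S = A by [].
by apply/eqP; rewrite eqEcard SA (leq_trans _ cS) // leq_min leqnn leqnSn.
Qed.

(** The flow of [v] is dominated in absolute value by the flow of [|v|], whose total is
    conserved. *)
Lemma flow_norm_le v t :
  \sum_(j in A) `|flow A W v t j| <= \sum_(j in A) `|v j|.
Proof.
rewrite -(flow_sum (fun i => `|v i|) t); apply: ler_sum => j.
elim: t j => //= t IH j jA; apply: le_trans (ler_norm_sum _ _ _) _.
apply: ler_sum => i iA; rewrite normrM (ger0_norm (mixing_ge0 mixW _ _ _)).
by rewrite ler_wpM2l ?IH ?(mixing_ge0 mixW).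
Qed.

(* The positive and the negative part of [v] have the same mass, and each of them
   puts a definite share of it on every agent, which cancels in the difference. *)
Lemma flow_contract v : \sum_(j in A) v j = 0 ->
  \sum_(j in A) `|flow A W v #|A| j| <=
    (1 - beta ^+ #|A|) * \sum_(j in A) `|v j|.
Proof.
move=> v0; have b0 := mixing_gt0 mixW.
have [->|[a aA]] := set_0Vmem A; first by rewrite !big_set0 mulr0.
have A0R : #|A|%:R != 0 :> R.
  by rewrite pnatr_eq0 -lt0n; apply/card_gt0P; exists a.
pose p i := (`|v i| + v i) / 2; pose q i := (`|v i| - v i) / 2.
have p0 : {in A, forall i, 0 <= p i}.
  by move=> i _; rewrite /p; have := ler_norm (- v i); rewrite normrN => ?; lra.
have q0 : {in A, forall i, 0 <= q i}.
  by move=> i _; rewrite /q; have := ler_norm (v i) => ?; lra.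
set s := \sum_(j in A) `|v j|.
have sp : \sum_(j in A) p j = s / 2.
  by rewrite -mulr_suml big_split /= v0 addr0.
have sq : \sum_(j in A) q j = s / 2.
  by rewrite -mulr_suml sumrB v0 subr0.
(* [d] is the share that [flow_spread] grants every agent from [p], and equally from [q], each of
   mass [s / 2]. Cancelling it twice at each of the [#|A|] agents saves [beta ^+ #|A| * s]. *)
set d := beta ^+ #|A| / #|A|%:R * (s / 2).
have -> : (1 - beta ^+ #|A|) * s = \sum_(j in A)
    (flow A W p #|A| j + flow A W q #|A| j - d *+ 2).
  rewrite sumrB big_split /= !flow_sum sp sq sumr_const /d -[_ *+ #|A|]mulr_natr.
  by field.
apply: ler_sum => j jA.
have -> : flow A W v #|A| j = flow A W p #|A| j - 1 * flow A W q #|A| j.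
  by rewrite -flowBZ; apply: eq_flow => // i _; rewrite /p /q; field.
have := flow_spread p0 jA; have := flow_spread q0 jA.
rewrite sp sq -/d => ? ?; rewrite ler_norml; apply/andP; split; lra.
Qed.

End Flow.

(** * Limits of flows and of ratios of flows *)

Section FlowLimit.
Context {R : realType} {T : finType} (A : {set T}).
Variables (beta : R) (W : nat -> T -> T -> R).
Hypothesis mixW : mixing A beta W.
Implicit Types x y v : T -> R.

(** The l1 norm is nonincreasing and nonnegative, so it has a limit. Passing to the limit in the
    contraction over [#|A|] steps forces this limit to be zero, with no need for a geometric
    rate. *)
Lemma flow_norm_cvg0 v : \sum_(j in A) v j = 0 ->
  \sum_(j in A) `|flow A W v t j| @[t --> \oo] --> 0.
Proof.
move=> v0; pose E t := \sum_(j in A) `|flow A W v t j|; rewrite -/E.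
have E_le s t : E (t + s)%N <= E s.
  rewrite /E (eq_bigr _ (fun j _ => congr1 _ (flow_shift A W v s t j))).
  exact: flow_norm_le (mixing_shift s mixW) _ _.
have EC s : E (s + #|A|)%N <= (1 - beta ^+ #|A|) * E s.
  rewrite addnC /E (eq_bigr _ (fun j _ => congr1 _ (flow_shift A W v s #|A| j))).
  apply: flow_contract (mixing_shift s mixW) _ _.
  by rewrite (flow_sum mixW).
have E0 s : 0 <= E s by apply: sumr_ge0.
have Ecvg : cvgn E.
  apply: nonincreasing_is_cvgn => [s t st|]; first by rewrite -(subnK st).
  by exists 0 => _ [s _ <-].
have L0 : 0 <= limn E by apply: limr_ge => //; apply: nearW.
have LC : limn E <= (1 - beta ^+ #|A|) * limn E.
  have c1 : E (s + #|A|)%N @[s --> \oo] --> limn E by rewrite cvg_shiftn.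
  have c2 : (1 - beta ^+ #|A|) * E s @[s --> \oo] -->
    (1 - beta ^+ #|A|) * limn E by apply: cvgMr.
  by apply: ler_cvg_to c1 c2 _; apply: nearW.
have bA : 0 < beta ^+ #|A| by rewrite exprn_gt0 ?(mixing_gt0 mixW).
have -> : 0 = limn E by nra.
by [].
Qed.

Lemma flow_cvg0 v j : \sum_(j in A) v j = 0 -> j \in A ->
  flow A W v t j @[t --> \oo] --> 0.
Proof.
move=> v0 jA; apply: norm_cvg0.
apply: squeeze_cvgr (cvg_cst _) (flow_norm_cvg0 v0); apply: nearW => t.
by rewrite normr_ge0 /= (bigD1 j) //= lerDl sumr_ge0.
Qed.

(* [y] differs by a zero-sum vector from a constant positive one, whose flow is
   bounded below by [flow_spread]. *)
Lemma flow_gt0_near y j : 0 < \sum_(i in A) y i -> j \in A ->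
  exists2 d, 0 < d & \forall t \near \oo, d <= flow A W y t j.
Proof.
move=> y0 jA; have b0 := mixing_gt0 mixW.
have A0R : 0 < #|A|%:R :> R by rewrite ltr0n; apply/card_gt0P; exists j.
(* [c] is the mean of [y], so the constant vector [c] has the same total as [y]. *)
set c := (\sum_(i in A) y i) / #|A|%:R.
have c0 : 0 < c by rewrite divr_gt0.
pose d := c * beta ^+ #|A|; have d0 : 0 < d by rewrite mulr_gt0 ?exprn_gt0.
exists (d / 2); first by rewrite divr_gt0.
have w0 : \sum_(i in A) (y i - c * 1) = 0.
  by rewrite sumrB sumr_const -[_ *+ _]mulr_natr /c; field; rewrite lt0r_neq0.
have d20 : 0 < d / 2 by rewrite divr_gt0.
have := cvgr0_norm_lt _ (flow_cvg0 w0 jA) _ d20.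
move=> near_w; near=> t.
have : `|flow A W y t j - c * flow A W (fun=> 1) t j| < d / 2.
  by rewrite -flowBZ; near: t; exact: near_w.
rewrite ltr_norml => /andP[yt _].
have tA : (#|A| <= t)%N by near: t; apply: nbhs_infty_ge.
suff ut : beta ^+ #|A| <= flow A W (fun=> 1) t j.
  have : d <= c * flow A W (fun=> 1) t j by rewrite /d ler_pM2l.
  by move=> ?; lra.
(* Only the last [#|A|] steps are used: they start from a nonnegative vector whose total is still
   [#|A|]. *)
rewrite -(subnKC tA) flow_shift.
apply: le_trans (flow_spread (mixing_shift _ mixW) _ jA).
  rewrite (flow_sum mixW) sumr_const.
  by rewrite mulfVK ?lt0r_neq0.
by move=> i iA; apply: (flow_ge0 mixW).
Unshelve. all: by end_near. Qed.

Lemma flow_ratio_cvg x y j : 0 < \sum_(i in A) y i -> j \in A ->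
  flow A W x t j / flow A W y t j @[t --> \oo] -->
    (\sum_(i in A) x i) / \sum_(i in A) y i.
Proof.
move=> y0 jA; set r := (\sum_(i in A) x i) / _.
have [d d0 yd] := flow_gt0_near y0 jA.
have w0 : \sum_(i in A) (x i - r * y i) = 0.
  by rewrite sumrB -mulr_sumr /r divfK ?lt0r_neq0 // subrr.
apply/subr_cvg0; apply: norm_cvg0.
(* Once the flow of [y] is at least [d], this sequence bounds the distance of the ratio from [r]. *)
have bd : d^-1 * `|flow A W (fun i => x i - r * y i) t j| @[t --> \oo] --> 0.
  rewrite -(mulr0 d^-1); apply: cvgMr.
  by rewrite -(@normr0 _ R); apply: cvg_norm; exact: flow_cvg0.
apply: squeeze_cvgr (cvg_cst _) bd; near=> t.
have yt : d <= flow A W y t j by near: t.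
have yt0 : 0 < flow A W y t j by exact: lt_le_trans yt.
rewrite normr_ge0 /= flowBZ.
rewrite (_ : _ - r = (flow A W y t j)^-1 *
  (flow A W x t j - r * flow A W y t j)); last by field; rewrite lt0r_neq0.
rewrite normrM ler_wpM2r // gtr0_norm ?invr_gt0 //.
by rewrite lef_pV2 ?posrE.
Unshelve. all: by end_near. Qed.

End FlowLimit.

(** * Conservation of mass in the open network *)

Section Network.
Context {n : nat} {N : open_network n} {link : nat -> {set 'I_n * 'I_n}}.
Context {R : realType}.
Hypothesis ackP : forall k j i, (j, i) \in edges N k -> (j, i) \in link k.
Implicit Types (k : nat) (i j l : 'I_n) (h : nat -> 'I_n -> R).

Lemma edge_active k i j : (j, i) \in edges N k ->
  (j \in active N k) && (i \in active N k).
Proof. by move/(subsetP (edges_active N k)); rewrite in_setX. Qed.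

Lemma mem_out_nbrs k i j : (j \in out_nbrs N k i) = ((j, i) \in edges N k).
Proof. by rewrite inE; apply: andb_idl => /edge_active/andP[]. Qed.

Lemma mem_in_nbrs k i j : (i \in in_nbrs N k j) = ((j, i) \in edges N k).
Proof. by rewrite inE; apply: andb_idl => /edge_active/andP[]. Qed.

Lemma mass_remaining h k j : j \in remaining N k ->
  mass N link h k.+1 j =
    \sum_(i in remaining N k) weight N link R k j i * mass N link h k i
    + \sum_(i in departing N k)
        dep_weight N link R k j i * (mass N link h k i - h k i).
Proof.
move=> jr; have [jA jA'] := setIP jr.
have -> : mass N link h k.+1 j =
    \sum_(i in (in_nbrs N k j :&: remaining N k) :|: [set j])
      weight N link R k j i * mass N link h k i
    + \sum_(i in in_nbrs N k j :&: departing N k)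
      dep_weight N link R k j i * (mass N link h k i - h k i).
  by rewrite /= in_setD jA /= jr.
congr (_ + _); rewrite big_mkcond [RHS]big_mkcond; apply: eq_bigr => i _.
  rewrite /weight; move: (remaining N k) jr => r jr.
  rewrite !in_setU !in_set1 !in_setI mem_in_nbrs mem_out_nbrs jr andbT.
  rewrite (eq_sym j); have [->|_] := eqVneq i j.
    by rewrite orbT jr.
  by rewrite !orbF; do 2!case: (_ \in _); rewrite ?mul0r.
have jD : j \notin departing N k by rewrite in_setD jA'.
rewrite /dep_weight; move: (departing N k) jD => D jD.
rewrite in_setI in_setD mem_in_nbrs mem_out_nbrs jD.
by do 2!case: (_ \in _); rewrite ?mul0r.
Qed.

(** By [ackP] the acknowledgements count the remaining out-neighbours exactly. As there are no
    self-edges, [i] itself is one further recipient, which matches the [1 +] in the denominator. *)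
Lemma weight_sum1 k i : i \in remaining N k ->
  \sum_(j in remaining N k) weight N link R k j i = 1.
Proof.
move=> ir; have c := ack_countE (fun l => @ackP k l i).
rewrite (eq_bigr _ (fun j _ => congr1 (fun b => if b && _ then _ else _) ir)) /=.
rewrite -big_mkcondr (eq_bigl (mem (i |: (out_nbrs N k i :&: remaining N k)))).
  rewrite sumr_const cardsU1 -c in_setI mem_out_nbrs.
  rewrite (negbTE (edges_irrefl N k i)) /= add1n nat1r -[_ *+ _]mulr_natr mul1r.
  by rewrite mulVf ?pnatr_eq0.
move=> j /=; move: (remaining N k) ir => r ir; rewrite !in_setU !in_set1 !in_setI.
by have [->|_] := eqVneq j i; rewrite ?ir ?orbT ?orbF //; do 2!case: (_ \in _).
Qed.

Lemma dep_weight_sum1 k i : i \in departing N k ->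
    (0 < #|out_nbrs N k i :&: remaining N k|)%N ->
  \sum_(j in remaining N k) dep_weight N link R k j i = 1.
Proof.
move=> iD c0; have c := ack_countE (fun l => @ackP k l i).
rewrite (eq_bigr _ (fun j _ => congr1 (fun b => if b && _ then _ else _) iD)) /=.
rewrite -big_mkcondr (eq_bigl (mem (out_nbrs N k i :&: remaining N k))).
  by rewrite sumr_const -c -[_ *+ _]mulr_natr mul1r mulVf // c pnatr_eq0 -lt0n.
by move=> j /=; rewrite !inE; do 3!case: (_ \in _).
Qed.

(** A departing agent needs a recipient: otherwise all its [dep_weight] would be zero and its excess
    would be lost. The premise on [remaining] admits times at which all active agents leave
    together. *)
Hypothesis depP : forall k j, (0 < #|remaining N k|)%N -> j \in departing N k ->
  (0 < #|out_nbrs N k j :&: remaining N k|)%N.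

(** Both totals change equally. Arriving agents add [h] to each; a departing agent passes on its
    excess over [h], so the left side, like the right, loses exactly [h]. *)
Lemma mass_sum h : (forall k j, j \in remaining N k -> h k.+1 j = h k j) ->
  forall k, \sum_(j in active N k) mass N link h k j =
    \sum_(j in active N k) h k j.
Proof.
move=> hS; elim=> [//|k IH].
rewrite (big_setID (active N k)) [RHS](big_setID (active N k)) /=.
rewrite [active N k.+1 :&: _]setIC -/(remaining N k) -/(arriving N k).
congr (_ + _); last by apply: eq_bigr => j ->.
rewrite [RHS](eq_bigr _ (@hS k)) (eq_bigr _ (@mass_remaining h k)).
(* If nobody remains, both sums are empty; otherwise [depP] applies. *)
have [->|[a ar]] := set_0Vmem (remaining N k); first by rewrite !big_set0.
have r0 : (0 < #|remaining N k|)%N by apply/card_gt0P; exists a.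
rewrite big_split /= exchange_big /= [X in _ + X]exchange_big /=.
transitivity (\sum_(i in remaining N k) mass N link h k i +
    \sum_(i in departing N k) (mass N link h k i - h k i)).
  congr (_ + _); apply: eq_bigr => i ik; rewrite -mulr_suml.
    by rewrite weight_sum1 // mul1r.
  by rewrite dep_weight_sum1 ?mul1r // depP.
rewrite sumrB addrA -(big_setID (active N k.+1) (mass N link h k)) IH.
by rewrite (big_setID (active N k.+1)) /= addrK.
Qed.

(** A remaining agent does not join at [k.+1], so this extra time enters the maximum in [last_join]
    only as the default value 0. *)
Lemma xhat_remaining (m : 'I_n -> nat -> R) k j : j \in remaining N k ->
  xhat N m k.+1 j = xhat N m k j.
Proof.
case/setIP=> jA jA'; rewrite /xhat jA jA' /last_join big_mkcond big_ord_recr /=.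
by rewrite -big_mkcond {2}/joins jA' jA /= maxn0.
Qed.

Lemma yhat_remaining k j : j \in remaining N k ->
  yhat N R k.+1 j = yhat N R k j.
Proof. by case/setIP=> jA jA'; rewrite /yhat jA jA'. Qed.

End Network.

(** * The stabilized network as a mixing flow *)

Section Stable.
Context {n : nat} {N : open_network n} {link : nat -> {set 'I_n * 'I_n}}.
Context {R : realType}.
Hypothesis connP : forall k, strongly_connected N k.
Hypothesis ackP : forall k j i, (j, i) \in edges N k -> (j, i) \in link k.
Variable k' : nat.
Hypothesis stable : forall k, (k' <= k)%N -> active N k = active N k'.

Lemma mass_stable (h : nat -> 'I_n -> R) t j : j \in active N k' ->
  mass N link h (t + k') j =
    flow (active N k') (fun s => weight N link R (s + k')) (mass N link h k') t j.
Proof.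
have act s : active N (s + k') = active N k' by apply: stable; rewrite leq_addl.
have rem s : remaining N (s + k') = active N k'.
  by rewrite /remaining -addSn !act setIid.
have dep s : departing N (s + k') = set0.
  by rewrite /departing -addSn !act setDv.
elim: t j => // t IH j jA; rewrite addSn mass_remaining ?rem // dep big_set0 addr0.
by apply: eq_bigr => i iA; rewrite IH.
Qed.

Lemma weight_mixing :
  mixing (active N k') (n.+1%:R^-1) (fun s => weight N link R (s + k')).
Proof.
have act s : active N (s + k') = active N k' by apply: stable; rewrite leq_addl.
have rem s : remaining N (s + k') = active N k'.
  by rewrite /remaining -addSn !act setIid.
(* Acknowledgements come from a subset of ['I_n], so the denominator is at most [n.+1]; this fixes
   the mixing constant. *)
have le_w k i : (n.+1%:R^-1 : R) <= 1 / (1 + (ack_count N link k i)%:R).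
  rewrite mul1r nat1r lef_pV2 ?posrE ?ltr0n // ler_nat ltnS.
  by rewrite (leq_trans (max_card _)) // card_ord.
split.
- by rewrite invr_gt0 ltr0n.
- by move=> t i j; rewrite /weight; case: ifP.
- by move=> t i iA; rewrite -(rem t) weight_sum1 ?rem.
- by move=> t i iA; rewrite /weight rem iA in_setU in_set1 eqxx orbT le_w.
move=> t S /properP[SA [a aA aS]] /set0Pn[b bS].
pose e := [rel u v | (v, u) \in edges N (t + k')].
(* If no edge left [S], every path from [b] would stay in [S], but strong connectivity gives one to
   [a]. *)
have [i iS [j [eij jS]]] : exists2 i, i \in S & exists j, e i j /\ j \notin S.
  apply: contrapT => no; move/negP: aS; apply.
  have /connectP[p pth ->] : connect e b a.
    by apply: connP; rewrite act //; exact: (subsetP SA).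
  elim: p b bS pth => //= c p IH b bS /andP[ebc /IH]; apply.
  by apply/negPn/negP => cS; apply: no; exists b => //; exists c.
have {}eij : (j, i) \in edges N (t + k') := eij.
have /andP[jA iA] := edge_active eij; rewrite act in jA iA.
exists i, j; split; rewrite // ?in_setD ?jS //.
by rewrite /weight rem iA in_setU in_setI mem_out_nbrs eij jA le_w.
Qed.

End Stable.

Theorem theorem2 (R : realType) (n : nat) (N : open_network n)
    (link : nat -> {set 'I_n * 'I_n}) (m : 'I_n -> nat -> R) (k' : nat)
    (Hconn : forall k, strongly_connected N k)
    (Hack : forall (k : nat) (j i : 'I_n),
        (j, i) \in edges N k -> (j, i) \in link k)
    (Hwd : forall (k : nat) (j : 'I_n), (0 < #|remaining N k|)%N ->
        j \in departing N k -> (0 < #|out_nbrs N k j :&: remaining N k|)%N)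
    (Hstab : forall k, (k' <= k)%N -> active N k = active N k')
    (j : 'I_n) (Hj : j \in active N k') :
  let avg : R :=
    1 / #|active N k'|%:R * \sum_(l in active N k') xhat N m k' l in
  [/\ \forall k \near \oo, openrc_y N link R k j != 0,
      openrc_z N link m k j @[k --> \oo] --> avg
    & openrc_x N link m k j / openrc_y N link R k j @[k --> \oo] --> avg].
Proof.
move=> avg.
pose A := active N k'; pose W s := weight N link R (s + k').
have mixW : mixing A (n.+1%:R^-1) W by exact: weight_mixing.
pose y := mass N link (yhat N R) k'; pose x := mass N link (xhat N m) k'.
have A0 : (0 < #|A|)%N by apply/card_gt0P; exists j.
(* Each active agent joins with [y]-mass 1, so the conserved total counts the active agents and the
   ratio of totals is the average. *)
have sumy : \sum_(i in A) y i = #|A|%:R.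
  rewrite (mass_sum Hack Hwd (@yhat_remaining _ _ _)) -sumr_const.
  by apply: eq_bigr => i iA; rewrite /yhat iA.
have sumx : \sum_(i in A) x i = \sum_(i in A) xhat N m k' i.
  by rewrite (mass_sum Hack Hwd (@xhat_remaining _ _ _ m)).
have y0 : 0 < \sum_(i in A) y i by rewrite sumy ltr0n.
have ratio : openrc_x N link m k j / openrc_y N link R k j @[k --> \oo] --> avg.
  rewrite -(cvg_shiftn k') /avg mul1r mulrC -/A -sumx -sumy.
  apply: cvg_trans (flow_ratio_cvg mixW (x := x) y0 Hj).
  apply: near_eq_cvg; apply: nearW => t.
  by rewrite /openrc_x /openrc_y /= !(mass_stable Hstab).
split=> //.
- have [d d0 [M _ yd]] := flow_gt0_near mixW y0 Hj.
  (* [M] counts time from [k'], hence the shift. *)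
  exists (M + k')%N => //= k Mk.
  have kk' : (k' <= k)%N by apply: leq_trans Mk; exact: leq_addl.
  rewrite -(subnK kk') /openrc_y (mass_stable Hstab) // gt_eqF //.
  by apply: lt_le_trans d0 _; apply: yd; rewrite /= leq_subRL // addnC.
(* From [k'] on [j] is active, so [openrc_z] is the quotient and not its default value 0. *)
- apply: cvg_trans ratio; apply: near_eq_cvg; near=> k.
  have kk' : (k' <= k)%N by near: k; apply: nbhs_infty_ge.
  by rewrite /openrc_z (Hstab _ kk') Hj.
Unshelve. all: by end_near. Qed.
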